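(* Let $A\in\mathbb{R}^{m\times n}$ and $1\le k\leq\operatorname{rank}(A)$. Let $V_k\in\mathbb{R}^{n\times k}$ be the matrix of the $k$ leading right singular vectors of $A$, and let $\mathcal{C}\subset\{1,\ldots,n\}$, $|\mathcal{C}|=k$, be the set of columns selected by mGKS, i.e. the set of pivot columns selected when Bischof-Stewart pivoting is applied (for $k$ steps) to $V_k^T\in\mathbb{R}^{k\times n}$. Then \[ \|A-P_{\mathcal{C}}A\|_2\leq\sqrt{1+k(n-k)}\,\sigma_{k+1}(A) \] and \[ \sigma_{\min}(A(:,\mathcal{C}))\geq\frac{\sigma_k(A)}{\sqrt{1+k(n-k)}}. \]
   Context: $\sigma_1(A)\ge\sigma_2(A)\ge\cdots$ are the singular values of $A$ (with $\sigma_{k+1}(A)=0$ if $k=\min(m,n)$); $\|\cdot\|_2$ is the spectral norm. $A(:,\mathcal{C})$ is the $m\times k$ submatrix of columns of $A$ indexed by $\mathcal{C}$; $\sigma_{\min}(A(:,\mathcal{C}))$ is its smallest ($k$-th) singular value; $P_{\mathcal{C}}$ is the orthogonal projector onto the span of the columns of $A(:,\mathcal{C})$. Exact arithmetic is assumed. Bischof-Stewart pivoting, applied to a matrix $B\in\mathbb{R}^{k\times n}$: columns are selected one at a time. Suppose $i$ columns have been selected, $0\le i<\min(k,n)$, and let $\Pi$ be a permutation matrix that moves the selected columns, in the order of selection, to the first $i$ positions. Write the partial QR factorization \[ B\Pi = \begin{bmatrix}Q_1 & Q_2\end{bmatrix}\begin{bmatrix}R_{11} & R_{12}\\ 0 &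 M\end{bmatrix}, \] with $\begin{bmatrix}Q_1 & Q_2\end{bmatrix}$ a $k\times k$ orthogonal matrix, $R_{11}\in\mathbb{R}^{i\times i}$ upper triangular, $R_{12}\in\mathbb{R}^{i\times(n-i)}$, and $M\in\mathbb{R}^{(k-i)\times(n-i)}$. The next pivot is the column of $B\Pi$ in position $i+j$, where $j\in\{1,\ldots,n-i\}$ minimizes \[ \frac{1+\|R_{11}^{-1}R_{12}e_j\|_2^2}{\|Me_j\|_2^2} \] over all $j$ with $Me_j\neq 0$; $e_j$ is the $j$-th standard basis vector. By convention, when $i=0$ the numerator is $1$, so the first pivot is a column of $B$ of largest Euclidean norm. Ties are broken arbitrarily. *)

(* Defs.v *)
From HB Require Import structures.
From mathcomp Require Import all_boot all_order all_algebra.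
From mathcomp Require Import perm polyrcf.
From mathcomp Require Import classical_sets reals.

Set Implicit Arguments.
Unset Strict Implicit.
Unset Printing Implicit Defensive.

Import Order.TTheory GRing.Theory Num.Theory.
Local Open Scope ring_scope.

Definition enorm (R : realType) n (x : 'cV[R]_n) : R :=
  Num.sqrt (\sum_i x i 0 ^+ 2).

Definition specnorm (R : realType) m n (A : 'M[R]_(m, n)) : R :=
  sup [set enorm (A *m x) | x in [set x : 'cV[R]_n | enorm x <= 1]]%classic.

Definition orthogonal_mx (R : realType) n (Q : 'M[R]_n) : Prop :=
  Q^T *m Q = 1%:M.

(* Roots are listed with their multiplicities.  For [p = char_poly (A^T *m A)]
   this lists all [n] eigenvalues, since a real symmetric matrix has only real
   eigenvalues. *)
Definition real_roots_mult (R : realType) (p : {poly R}) : seq R :=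
  flatten [seq nseq (mup x p) x | x <- rootsR p].

Definition singular_values (R : realType) m n (A : 'M[R]_(m, n)) : seq R :=
  sort >=%R [seq Num.sqrt x | x <- real_roots_mult (char_poly (A^T *m A))].

(* Indexed from 1, so [singval A 1] is the largest singular value;
   [singval A i = 0] for every [i > minn m n]. *)
Definition singval (R : realType) m n (A : 'M[R]_(m, n)) (i : nat) : R :=
  (singular_values A)`_i.-1.

(* Used for matrices with at least as many rows as columns. *)
Definition sigma_min (R : realType) m n (A : 'M[R]_(m, n)) : R := singval A n.

Definition is_svd (R : realType) m n (A : 'M[R]_(m, n))
    (U : 'M[R]_m) (V : 'M[R]_n) : Prop :=
  [/\ orthogonal_mx U, orthogonal_mx V &
      A = U *m (\matrix_(i < m, j < n)
                  if i == j :> nat then singval A i.+1 else 0) *m V^T].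

Definition leading_right_singular_vectors (R : realType) m n k
    (A : 'M[R]_(m, n)) (Vk : 'M[R]_(n, k)) : Prop :=
  exists (le_kn : (k <= n)%N) (U : 'M[R]_m) (V : 'M[R]_n),
    is_svd A U V /\ Vk = colsub (widen_ord le_kn) V.

Definition cols (R : realType) m n (A : 'M[R]_(m, n)) (C : {set 'I_n}) :
    'M[R]_(m, #|C|) :=
  colsub (@enum_val _ (mem C)) A.

(* [proj_mx] acts on row vectors, on the right: transposed, it projects onto
   the column space of X, along the orthogonal complement of that space (the
   rows of [kermx X] span the u such that [u *m X = 0]). *)
Definition orthoproj (R : realType) m p (X : 'M[R]_(m, p)) : 'M[R]_m :=
  (proj_mx <<X^T>>%MS (kermx X))^T.

Definition pivot_ratio (R : realType) i p q (R11 : 'M[R]_i)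
    (R12 : 'M[R]_(i, q)) (M : 'M[R]_(p, q)) (j : 'I_q) : R :=
  (1 + enorm (invmx R11 *m col j R12) ^+ 2) / enorm (col j M) ^+ 2.

(* Given the columns [s] selected so far, in order, [c] may be the next pivot.
   Column [l] of [col_perm Pi B] is column [Pi l] of [B].  The ratio does not
   depend on the choice of [Pi] and of the QR factorization, except for the
   order in which [Pi] lists the columns not yet selected. *)
Definition bischof_stewart_step (R : realType) k n (B : 'M[R]_(k, n))
    (s : seq 'I_n) (c : 'I_n) : Prop :=
  let i := size s in
  exists (le_ik : (i <= k)%N) (le_in : (i <= n)%N) (Pi : 'S_n) (Q : 'M[R]_k)
         (R11 : 'M[R]_i) (R12 : 'M[R]_(i, n - i)) (M : 'M[R]_(k - i, n - i))
         (j : 'I_(n - i)),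
    let pos := cast_ord (subnKC le_in) in
    [/\ forall l : 'I_i, Pi (pos (lshift (n - i) l)) = tnth (in_tuple s) l,
        [/\ orthogonal_mx Q, is_trig_mx R11^T &
            col_perm Pi B =
              Q *m castmx (subnKC le_ik, subnKC le_in)
                          (block_mx R11 R12 0 M)],
        col j M != 0,
        (forall j' : 'I_(n - i), col j' M != 0 ->
           pivot_ratio R11 R12 M j <= pivot_ratio R11 R12 M j') &
        c = Pi (pos (rshift i j))].

Definition bischof_stewart (R : realType) k n (B : 'M[R]_(k, n))
    (s : seq 'I_n) : Prop :=
  forall (s1 s2 : seq 'I_n) (c : 'I_n), s = s1 ++ c :: s2 ->
    bischof_stewart_step B s1 c.

(* [C] is the set of pivot columns of some run of k steps on Vk^T. *)
Definition mGKS_selects (R : realType) n k (Vk : 'M[R]_(n, k))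
    (C : {set 'I_n}) : Prop :=
  exists s : k.-tuple 'I_n, bischof_stewart Vk^T s /\ C = [set c in s].

(* Main.v *)
Require Import Defs.
From mathcomp Require Import all_boot all_order all_algebra.
From mathcomp Require Import reals.
From mathcomp Require Import perm polyrcf complex spectral ring lra zify.
Import Order.TTheory GRing.Theory Num.Theory.
Local Open Scope ring_scope.

Set Implicit Arguments.
Unset Strict Implicit.
Unset Printing Implicit Defensive.

(** Write [B = Vk^T], a [k x n] matrix with orthonormal rows.

    Bischof-Stewart pivoting greedily keeps small a family of vectors dual to
    the selected columns of [B] (a left inverse of the submatrix that they
    form).  When the pivot [c] is added, such a family can be updated so that
    the sum of its squared norms grows by at most the pivot ratio of [c]
    ([dual_update]).  The minimal ratio is at most the quotient of the sum of
    the numerators by the sum of the denominators, and orthonormality of the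
    rows of [B] evaluates both sums ([pivot_ratio_le]).  The resulting recursion
    bounds the sum after [i] steps by [i + i (n - k) / (k - i + 1)]
    ([bischof_stewart_dual]).  After [k] steps this yields a matrix [L], with
    rows supported on [C] and [B L = 1], of squared Frobenius norm at most
    [k + k (n - k)] ([bischof_stewart_inverse]).

    On the columns in [C] the matrix [W = L B] is the identity, which accounts
    for [k] in the squared norm of [W], equal to that of [L]; hence the other
    columns of [W] have squared norm at most [k (n - k)].  Two consequences
    follow.  Every [x] is [z + y] with [B z = 0], [y] supported on [C] and
    [|z|^2 <= (1 + k (n - k)) |x|^2] ([kernel_representative]); and
    [|w|^2 <= (1 + k (n - k)) |B w|^2] for every [w] supported on [C]
    ([fro2_le_mul_selected]).

    The singular value decomposition transfers both to [A].  The residual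
    projection kills [A y], and [|A z| <= sigma_(k+1) |z|], whence the first
    inequality.  Since [|A w| >= sigma_k |B w|], every eigenvalue of the Gram
    matrix of [A(:, C)] is at least [sigma_k^2 / (1 + k (n - k))].  The singular
    values are defined through the real roots of the characteristic polynomial
    of that Gram matrix, so the second inequality also needs that this
    polynomial splits over the reals ([char_poly_symmetric_split]). *)

(** * The squared Frobenius norm *)

(** The squared Frobenius norm; on a column it is the squared Euclidean norm. *)
Definition fro2 (R : comPzRingType) m n (A : 'M[R]_(m, n)) : R := \tr (A^T *m A).

Section Fro2.
Variable R : realFieldType.

Lemma fro2E m n (A : 'M[R]_(m, n)) : fro2 A = \sum_i \sum_j A i j ^+ 2.
Proof.
rewrite exchange_big; apply: eq_bigr => j _; rewrite mxE.
by apply: eq_bigr => i _; rewrite mxE expr2.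
Qed.

Lemma fro2_ge0 m n (A : 'M[R]_(m, n)) : 0 <= fro2 A.
Proof. by rewrite fro2E; do 2!apply: sumr_ge0 => ? _; apply: sqr_ge0. Qed.

Lemma fro2_eq0 m n (A : 'M[R]_(m, n)) : fro2 A = 0 -> A = 0.
Proof.
have rowge0 i : 0 <= \sum_j A i j ^+ 2 by apply: sumr_ge0 => ? _; apply: sqr_ge0.
rewrite fro2E => /(psumr_eq0P (fun i _ => rowge0 i)) A0.
apply/matrixP => i j; rewrite mxE; apply/eqP; rewrite -sqrf_eq0; apply/eqP.
by apply: (psumr_eq0P _ (A0 i isT)) => // ? _; apply: sqr_ge0.
Qed.

Lemma fro2_tr m n (A : 'M[R]_(m, n)) : fro2 A^T = fro2 A.
Proof. by rewrite /fro2 trmxK mxtrace_mulC. Qed.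

Lemma fro2_rows m n (A : 'M[R]_(m, n)) : fro2 A = \sum_i fro2 (row i A).
Proof.
rewrite fro2E; apply: eq_bigr => i _; rewrite fro2E big_ord1.
by apply: eq_bigr => j _; rewrite mxE.
Qed.

Lemma fro2_cols m n (A : 'M[R]_(m, n)) : fro2 A = \sum_j fro2 (col j A).
Proof.
by rewrite -fro2_tr fro2_rows; apply: eq_bigr => j _; rewrite -tr_col fro2_tr.
Qed.

Lemma fro2_cV n (x : 'cV[R]_n) : fro2 x = \sum_i x i 0 ^+ 2.
Proof. by rewrite fro2E; apply: eq_bigr => i _; rewrite big_ord1. Qed.

Lemma fro20 m n : fro2 (0 : 'M[R]_(m, n)) = 0.
Proof. by rewrite /fro2 mulmx0 mxtrace0. Qed.

Lemma fro2_row_mx m n1 n2 (A : 'M[R]_(m, n1)) (B : 'M[R]_(m, n2)) :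
  fro2 (row_mx A B) = fro2 A + fro2 B.
Proof.
by rewrite -fro2_tr tr_row_mx /fro2 tr_col_mx !trmxK mul_row_col raddfD /= mxtrace_mulC
  (mxtrace_mulC B).
Qed.

Lemma fro2Z m n a (A : 'M[R]_(m, n)) : fro2 (a *: A) = a ^+ 2 * fro2 A.
Proof. by rewrite /fro2 [(_ *: _)^T]linearZ /= -scalemxAl -scalemxAr !mxtraceZ mulrA expr2. Qed.

Lemma fro2D m n (A B : 'M[R]_(m, n)) :
  fro2 (A + B) = fro2 A + \tr (A^T *m B) *+ 2 + fro2 B.
Proof.
rewrite /fro2 [(A + B)^T]linearD mulmxDl !mulmxDr !mxtraceD /= mulr2n.
by rewrite -(mxtrace_tr (B^T *m A)) trmx_mul trmxK !addrA.
Qed.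

Lemma fro2_orth m n (A B : 'M[R]_(m, n)) :
  \tr (A^T *m B) = 0 -> fro2 (A + B) = fro2 A + fro2 B.
Proof. by move=> AB; rewrite fro2D AB mul0rn addr0. Qed.

Lemma fro2N m n (A : 'M[R]_(m, n)) : fro2 (- A) = fro2 A.
Proof. by rewrite -scaleN1r fro2Z sqrrN expr1n mul1r. Qed.

Lemma fro2_isometry p m n (Q : 'M[R]_(p, m)) (A : 'M[R]_(m, n)) :
  Q^T *m Q = 1%:M -> fro2 (Q *m A) = fro2 A.
Proof. by move=> Q1; rewrite /fro2 trmx_mul mulmxA -(mulmxA _ _ Q) Q1 mulmx1. Qed.

Lemma Cauchy_Schwarz_fro2 m n (A B : 'M[R]_(m, n)) :
  \tr (A^T *m B) ^+ 2 <= fro2 A * fro2 B.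
Proof.
have [B0|B0] := eqVneq (fro2 B) 0.
  by rewrite B0 (fro2_eq0 B0) mulmx0 mxtrace0 expr0n mulr0.
have B_gt0 : 0 < fro2 B by rewrite lt_def B0 fro2_ge0.
have := fro2_ge0 (fro2 B *: A + (- \tr (A^T *m B)) *: B).
rewrite fro2D !fro2Z [(_ *: _)^T]linearZ /= -scalemxAl -scalemxAr !mxtraceZ.
set t := \tr _ => ge0.
rewrite -subr_ge0 -(pmulr_rge0 _ B_gt0); apply: le_trans ge0 _.
by rewrite le_eqVlt; apply/orP; left; apply/eqP; rewrite mulr2n; ring.
Qed.

(** The spectral norm is at most the Frobenius norm. *)
Lemma fro2_mulmx_cV m n (A : 'M[R]_(m, n)) (x : 'cV[R]_n) :
  fro2 (A *m x) <= fro2 A * fro2 x.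
Proof.
rewrite [fro2 (A *m x)]fro2_rows [fro2 A]fro2_rows mulr_suml.
apply: ler_sum => i _; rewrite row_mul fro2_cV big_ord1.
have := Cauchy_Schwarz_fro2 (row i A)^T x.
by rewrite trmxK fro2_tr trace_mx11.
Qed.

End Fro2.

Lemma enorm_sqr (R : realType) n (x : 'cV[R]_n) : enorm x ^+ 2 = fro2 x.
Proof.
rewrite /enorm fro2_cV sqr_sqrtr //.
by apply: sumr_ge0 => ? _; apply: sqr_ge0.
Qed.

Lemma enormE (R : realType) n (x : 'cV[R]_n) : enorm x = Num.sqrt (fro2 x).
Proof. by rewrite /enorm fro2_cV. Qed.

(** * One pivoting step *)

Section Step.
Variable R : realType.

Lemma mulmx_col m n p (A : 'M[R]_(m, n)) (B : 'M[R]_(n, p)) j :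
  A *m col j B = col j (A *m B).
Proof. by rewrite !colEsub mulmx_colsub. Qed.

Lemma mulmx_lsubmx m n p q (A : 'M[R]_(m, n)) (B : 'M[R]_(n, p + q)) :
  A *m lsubmx B = lsubmx (A *m B).
Proof. by rewrite !lsubmxEsub mulmx_colsub. Qed.

(** The minimal pivot ratio is at most the sum of all numerators divided by the
    sum of all denominators: these sums are [q + (fro2 L - i)] and [p], with [L]
    the inverse of [R11]. *)
Lemma pivot_ratio_le i p q (R11 : 'M[R]_i) (R12 : 'M[R]_(i, q))
    (M : 'M[R]_(p, q)) (L : 'M[R]_i) (j : 'I_q) :
  block_mx R11 R12 0 M *m (block_mx R11 R12 0 M)^T = 1%:M ->
  L *m R11 = 1%:M ->
  (forall j', col j' M != 0 -> pivot_ratio R11 R12 M j <= pivot_ratio R11 R12 M j') ->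
  pivot_ratio R11 R12 M j * p%:R <= q%:R + (fro2 L - i%:R).
Proof.
rewrite tr_block_mx mulmx_block trmx0 !mul0mx !mulmx0 !add0r scalar_mx_block.
case/eq_block_mx => RR _ _ MM LR min_j.
have [_ R11u] := mulmx1_unit LR.
have invR : invmx R11 = L by rewrite -[LHS]mul1mx -LR -mulmxA mulmxV // mulmx1.
have <- : fro2 M = p%:R by rewrite -fro2_tr /fro2 trmxK MM mxtrace1.
(* [R11 R11^T + R12 R12^T = 1] is multiplied by [L] and [L^T]. *)
have <- : fro2 (L *m R12) = fro2 L - i%:R.
  rewrite -fro2_tr /fro2 trmxK trmx_mul mulmxA -(mulmxA L).
  rewrite (_ : R12 *m R12^T = 1%:M - R11 *m R11^T); last by rewrite -RR addrC addKr.
  rewrite mulmxBr mulmx1 mulmxA LR mul1mx mulmxBl -trmx_mul LR trmx1 raddfB /= mxtrace1.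
  by rewrite mxtrace_mulC.
rewrite (fro2_cols M) mulr_sumr (fro2_cols (L *m R12)).
rewrite -[q in q%:R]card_ord -sum1_card natr_sum -big_split /=.
apply: ler_sum => j' _.
have [->|Mj'] := eqVneq (col j' M) 0.
  by rewrite fro20 mulr0 addr_ge0 ?ler01 ?fro2_ge0.
have Mj'_gt0 : 0 < fro2 (col j' M).
  by rewrite lt_def fro2_ge0 andbT; apply: contraNneq Mj' => /fro2_eq0/eqP.
have := min_j _ Mj'; rewrite [X in _ <= X]/pivot_ratio !enorm_sqr invR.
by rewrite mulmx_col ler_pdivlMr.
Qed.

(** Updating a family dual to the first [i] columns when one more column [c] is
    selected: the vectors of the old family are multiplied by [T], and [u] is
    added.  Here [T] projects orthogonally onto the span of the first [i]
    columns and then subtracts the multiple of [u] that makes the result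
    orthogonal to [c]; and [u] is proportional to the component of [c]
    orthogonal to that span. *)
Lemma dual_update i p q (Q : 'M[R]_(i + p)) (R11 : 'M[R]_i) (R12 : 'M[R]_(i, q))
    (M : 'M[R]_(p, q)) (j : 'I_q) (B : 'M[R]_(i + p, i + q)) :
  orthogonal_mx Q -> B = Q *m block_mx R11 R12 0 M -> B *m B^T = 1%:M ->
  col j M != 0 ->
  (forall j', col j' M != 0 -> pivot_ratio R11 R12 M j <= pivot_ratio R11 R12 M j') ->
  exists (T : 'M[R]_(i + p)) (u : 'rV[R]_(i + p)),
    [/\ T *m lsubmx B = lsubmx B, T *m col (rshift i j) B = 0,
        u *m lsubmx B = 0, u *m col (rshift i j) B = 1%:M &
        forall L : 'M[R]_(i, i + p), L *m lsubmx B = 1%:M ->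
          (fro2 (L *m T) + fro2 u - fro2 L) * p%:R
            <= q%:R + (fro2 L - i%:R)].
Proof.
rewrite /orthogonal_mx => Q1 defB BB Mj0 min_j.
have QQ : Q *m Q^T = 1%:M by apply: mulmx1C.
set r := col j R12; set v := col j M; pose a := (fro2 v)^-1.
have v_gt0 : 0 < fro2 v.
  by rewrite lt_def fro2_ge0 andbT; apply: contraNneq Mj0 => /fro2_eq0/eqP.
have a_v : a * fro2 v = 1 by rewrite mulVf ?gt_eqF.
have vv : v^T *m v = (fro2 v)%:M by rewrite [LHS]mx11_scalar /fro2 trace_mx11.
have Bl : lsubmx B = Q *m col_mx R11 0.
  by rewrite defB -mulmx_lsubmx block_mxEh row_mxKl.
have Bc : col (rshift i j) B = Q *m col_mx r v.
  by rewrite defB -mulmx_col block_mxEh colKr col_col_mx.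
exists (Q *m block_mx 1%:M (- a *: (r *m v^T)) 0 0 *m Q^T), (a *: row_mx 0 v^T *m Q^T).
split.
- rewrite Bl -!mulmxA (mulmxA Q^T) Q1 mul1mx mul_block_col.
  by rewrite mul1mx !mulmx0 mul0mx !addr0.
- rewrite Bc -!mulmxA (mulmxA Q^T) Q1 mul1mx mul_block_col !mul0mx addr0 mul1mx.
  rewrite -scalemxAl -mulmxA vv mul_mx_scalar scalerA mulNr a_v scaleN1r subrr.
  by rewrite col_mx0 mulmx0.
- by rewrite Bl -!mulmxA (mulmxA Q^T) Q1 mul1mx -scalemxAl mul_row_col mul0mx mulmx0 addr0 scaler0.
- rewrite Bc -!mulmxA (mulmxA Q^T) Q1 mul1mx -scalemxAl mul_row_col mul0mx add0r vv.
  by rewrite scale_scalar_mx a_v.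
move=> L0 L0B.
have -> : fro2 L0 = fro2 (L0 *m Q).
  by rewrite -[RHS]fro2_tr trmx_mul fro2_isometry ?trmxK // fro2_tr.
have froQ n (X : 'M[R]_(n, i + p)) : fro2 (X *m Q^T) = fro2 X.
  by rewrite -(fro2_tr (X *m Q^T)) -(fro2_tr X) trmx_mul trmxK fro2_isometry.
(* In the coordinates given by [Q], the left inverse is [row_mx La Lb] with
   [La] the inverse of [R11]. *)
rewrite !mulmxA !froQ; move: L0B; rewrite Bl mulmxA; move: (L0 *m Q) => L.
rewrite -[L]hsubmxK; move: (lsubmx L) (rsubmx L) => La Lb {L L0 froQ}.
rewrite mul_row_col mulmx0 addr0 mul_row_block !mulmx0 !addr0 mulmx1 => LR.
have BB' : block_mx R11 R12 0 M *m (block_mx R11 R12 0 M)^T = 1%:M.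
  have -> : block_mx R11 R12 0 M = Q^T *m B by rewrite defB mulmxA Q1 mul1mx.
  by rewrite trmx_mul trmxK mulmxA -(mulmxA _ B) BB mulmx1 Q1.
have := pivot_ratio_le BB' LR min_j.
have -> : pivot_ratio R11 R12 M j = a * (1 + fro2 (La *m r)).
  rewrite /pivot_ratio !enorm_sqr mulrC; congr (_ * (1 + fro2 (_ *m _))).
  have [_ R11u] := mulmx1_unit LR.
  by rewrite -[LHS]mul1mx -LR -mulmxA mulmxV // mulmx1.
have -> : fro2 (a *: row_mx (0 : 'M_(1, i)) v^T) = a.
  by rewrite fro2Z fro2_row_mx fro20 add0r fro2_tr expr2 -mulrA a_v mulr1.
rewrite !fro2_row_mx -scalemxAr mulmxA fro2Z sqrrN.
have -> : fro2 (La *m r *m v^T) = fro2 (La *m r) * fro2 v.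
  move: (La *m r) => x; rewrite /fro2 trmx_mul trmxK !mulmxA -(mulmxA v) [x^T *m x]mx11_scalar.
  by rewrite mul_mx_scalar -scalemxAl mxtraceZ (mxtrace_mulC v) mxtrace_scalar.
have -> : a ^+ 2 * (fro2 (La *m r) * fro2 v) = a * fro2 (La *m r).
  by rewrite mulrCA expr2 -(mulrA a) a_v mulr1 mulrC.
move=> le_piv; have := fro2_ge0 Lb; have := ler0n R p; nra.
Qed.

(** [dual_update] when the selected columns are brought to the front by a
    permutation. *)
Lemma dual_update_perm i p q k n (ek : (i + p)%N = k) (en : (i + q)%N = n)
    (Pi : 'S_n) (Q : 'M[R]_k) (R11 : 'M[R]_i) (R12 : 'M[R]_(i, q))
    (M : 'M[R]_(p, q)) (j : 'I_q) (B : 'M[R]_(k, n)) (s : 'I_i -> 'I_n) (c : 'I_n) :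
  (forall l, Pi (cast_ord en (lshift q l)) = s l) ->
  c = Pi (cast_ord en (rshift i j)) ->
  orthogonal_mx Q ->
  col_perm Pi B = Q *m castmx (ek, en) (block_mx R11 R12 0 M) ->
  B *m B^T = 1%:M -> col j M != 0 ->
  (forall j', col j' M != 0 -> pivot_ratio R11 R12 M j <= pivot_ratio R11 R12 M j') ->
  (forall l, s l != c) /\
  exists (T : 'M[R]_k) (u : 'rV[R]_k),
    [/\ forall l, T *m col (s l) B = col (s l) B, T *m col c B = 0,
        forall l, u *m col (s l) B = 0, u *m col c B = 1%:M &
        forall L : 'M[R]_(i, k), L *m colsub s B = 1%:M ->
          (fro2 (L *m T) + fro2 u - fro2 L) * p%:R
            <= q%:R + (fro2 L - i%:R)].
Proof.
case: k / ek Q B => Q B; case: n / en Pi B s c => Pi B s c.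
rewrite castmx_id => defs -> Q1 defB BB Mj0 min_j.
have BB' : col_perm Pi B *m (col_perm Pi B)^T = 1%:M.
  by rewrite col_permE trmx_mul mulmxA -(mulmxA B) tr_perm_mx -perm_mxM mulgV perm_mx1 mulmx1.
split=> [l|].
  rewrite -defs (inj_eq perm_inj) cast_ord_id; apply/negP => /eqP /(congr1 val) /= e.
  by have := ltn_ord l; rewrite e ltnNge leq_addr.
have [T [u [TB Tc uB uc TL]]] := dual_update Q1 defB BB' Mj0 min_j.
have subB : lsubmx (col_perm Pi B) = colsub s B.
  by apply/matrixP => a l; rewrite !mxE -defs cast_ord_id.
have colc : col (rshift i j) (col_perm Pi B) = col (Pi (cast_ord erefl (rshift i j))) B.
  by apply/matrixP => a l; rewrite !mxE cast_ord_id.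
have cols l : col (s l) B = col l (lsubmx (col_perm Pi B)).
  by rewrite subB; apply/matrixP => a b; rewrite !mxE.
exists T, u; split=> [l||l||L]; rewrite -?colc //.
- by rewrite cols mulmx_col TB.
- by rewrite cols mulmx_col uB; apply/matrixP => a b; rewrite !mxE.
- by rewrite -subB; apply: TL.
Qed.

(** The rows of [L] indexed by [s] form a family dual to the columns of [B]
    indexed by [s]; the other rows of [L] are arbitrary. *)
Definition dual_on k n (B : 'M[R]_(k, n)) (s : seq 'I_n) (L : 'M[R]_(n, k)) : Prop :=
  {in s &, forall a b, (L *m B) a b = (a == b)%:R}.

(** One pivoting step: the growth [f' - f] of the sum [f] of the squared norms
    of a dual family satisfies [(f' - f) (k - i) <= n - i + (f - i)]. *)
Lemma bischof_stewart_step_dual k n (B : 'M[R]_(k, n)) s c (L : 'M[R]_(n, k)) :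
  B *m B^T = 1%:M -> uniq s -> bischof_stewart_step B s c -> dual_on B s L ->
  let f := \sum_(a <- s) fro2 (row a L) in
  [/\ c \notin s, (size s < k)%N & exists2 L', dual_on B (rcons s c) L' &
    (\sum_(a <- rcons s c) fro2 (row a L') - f) * (k - size s)%N%:R
       <= (n - size s)%N%:R + (f - (size s)%:R)].
Proof.
move=> BB Us [le_ik [le_in [Pi [Q [R11 [R12 [M [j]]]]]]]] /=.
case=> [defs [Q1 _ defB] Mj0 min_j defc] LB.
have [sc [T [u [TB Tc uB uc TL]]]] :=
  dual_update_perm defs defc Q1 defB BB Mj0 min_j.
have csF : c \notin s.
  by apply/negP => /(tnthP (in_tuple s)) [l cl]; have := sc l; rewrite -cl eqxx.
split=> //.
  rewrite ltnNge; apply: contra Mj0 => le_ki; apply/eqP/matrixP => a.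
  by move=> b; exfalso; have := ltn_ord a; lia.
have mulE (A : 'M[R]_(n, k)) a b : (A *m B) a b = (row a A *m col b B) 0 0.
  by rewrite !mxE; apply: eq_bigr => l _; rewrite !mxE.
pose L' := \matrix_(a < n) (if a == c then u else row a L *m T).
have rowc : row c L' = u by rewrite rowK eqxx.
have rows a : a \in s -> row a L' = row a L *m T.
  by move=> sa; rewrite rowK; case: eqP => // ac; rewrite -ac sa in csF.
have sP b : b \in s -> exists l, b = tnth (in_tuple s) l by move/(tnthP (in_tuple s)).
have neq a : a \in s -> (a == c) = false.
  by move=> sa; apply/eqP => ac; rewrite -ac sa in csF.
exists L'.
  move=> a b; rewrite !mem_rcons !inE mulE.
  have [->|_] := eqVneq a c => /=; last move=> sa; have [->|_] := eqVneq b c => /=.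
  - by rewrite rowc uc mxE eqxx.
  - by move=> _ sb; rewrite rowc; have [l ->] := sP _ sb; rewrite uB mxE.
  - by rewrite rows // -mulmxA Tc mulmx0 mxE (neq a).
  - move=> sb; have [l bl] := sP _ sb.
    by rewrite rows // -mulmxA bl TB -bl -mulE LB.
rewrite -cats1 big_cat big_seq1 /= rowc.
rewrite (eq_big_seq (fun a => fro2 (row a (L *m T)))); last first.
  by move=> a sa; rewrite rows // row_mul.
pose L1 := rowsub (tnth (in_tuple s)) L.
have sumE (X : 'M[R]_(n, k)) :
    \sum_(a <- s) fro2 (row a X) = fro2 (rowsub (tnth (in_tuple s)) X).
  rewrite big_tnth fro2_rows; apply: eq_bigr => l _; congr fro2.
  by apply/matrixP => a b; rewrite !mxE.
have -> : \sum_(a <- s) fro2 (row a (L *m T)) = fro2 (L1 *m T).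
  by rewrite sumE mul_rowsub_mx.
rewrite (sumE L); apply: TL; apply/matrixP => l l'.
rewrite mulmx_colsub mul_rowsub_mx 2!mxE LB ?mem_tnth // mxE.
by rewrite (inj_eq (tuple_uniqP (in_tuple s) Us)).
Qed.

End Step.

(** * The selected columns of a matrix with orthonormal rows *)

(** A product only involves the columns and rows in [C] when the other rows of
    the second factor vanish. *)
Lemma mulmx_supported (R : pzRingType) m n p (C : {set 'I_n}) (X : 'M[R]_(m, n))
    (Y : 'M[R]_(n, p)) :
  (forall a, a \notin C -> row a Y = 0) ->
  X *m Y = colsub (@enum_val _ (mem C)) X *m rowsub (@enum_val _ (mem C)) Y.
Proof.
move=> Y0; apply/matrixP => i j.
rewrite !mxE (bigID (mem C)) /= addrC big1 ?add0r => [|a aC].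
  by rewrite big_enum_val; apply: eq_bigr => a _; rewrite !mxE.
by have /rowP/(_ j) := Y0 a aC; rewrite !mxE => ->; rewrite mulr0.
Qed.

Section Selection.
Variables (R : realType) (k n : nat) (B : 'M[R]_(k, n)).
Hypotheses (le_kn : (k <= n)%N) (BB : B *m B^T = 1%:M).

(** After [i] steps the selected columns have a dual family whose squared norms
    sum to at most [i + i (n - k) / (k - i + 1)], the solution of the recursion
    given by [bischof_stewart_step_dual]. *)
Lemma bischof_stewart_dual s : bischof_stewart B s ->
  [/\ uniq s, (size s <= k)%N & exists2 L, dual_on B s L &
    (\sum_(a <- s) fro2 (row a L) - (size s)%:R) * (k%:R + 1 - (size s)%:R)
      <= (size s)%:R * (n%:R - k%:R)].
Proof.
elim/last_ind: s => [|s c IHs] BSs.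
  split=> //; exists 0; first by move=> a b; rewrite in_nil.
  by rewrite big_nil subrr !mul0r.
have [|Us ski [L LB fL]] := IHs.
  by move=> s1 s2 d defs; apply: (BSs s1 (rcons s2 c)); rewrite defs rcons_cat.
have BSc : bischof_stewart_step B s c by apply: (BSs s [::]); rewrite cats1.
have [cs lt_sk [L' LB' fL']] := bischof_stewart_step_dual BB Us BSc LB.
split; rewrite ?rcons_uniq ?size_rcons ?cs //.
exists L' => //; move: fL fL'.
rewrite !natrB ?(leq_trans ski) // -[(size s).+1]addn1 natrD.
nra.
Qed.

Variables (s : k.-tuple 'I_n).
Let C := [set c in s].

(** After [k] steps the selected columns form a square matrix, so that its left
    inverse, padded with zero rows, is a right inverse of [B]. *)
Lemma bischof_stewart_inverse : bischof_stewart B s ->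
  #|C| = k /\ exists L : 'M[R]_(n, k),
    [/\ forall a, a \notin C -> row a L = 0, dual_on B s L, B *m L = 1%:M &
        fro2 L <= k%:R + k%:R * (n%:R - k%:R)].
Proof.
move/bischof_stewart_dual => [Us _ [L LB fL]].
have cardC : #|C| = k by rewrite cardsE (card_uniqP Us) size_tuple.
split=> //; pose L' := \matrix_(a < n) (if a \in C then row a L else 0).
have rowL' a : row a L' = if a \in C then row a L else 0 by rewrite rowK.
have LB' : dual_on B s L'.
  move=> a b sa sb; rewrite -LB //.
  suff : row a (L' *m B) = row a (L *m B) by move/rowP/(_ b); rewrite [LHS]mxE [RHS]mxE.
  by rewrite !row_mul rowL' inE sa.
exists L'; split=> //.
- by move=> a aC; rewrite rowL' (negPf aC).
- suff inv p (e : p = k) (X : 'M[R]_(k, p)) (Y : 'M[R]_(p, k)) :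
      Y *m X = 1%:M -> X *m Y = 1%:M.
    rewrite (@mulmx_supported _ _ _ _ C) => [|a aC]; last by rewrite rowL' (negPf aC).
    apply: (inv _ cardC).
    rewrite mulmx_colsub mul_rowsub_mx; apply/matrixP => i j.
    have Cs l : @enum_val _ (mem C) l \in s by have := enum_valP l; rewrite inE.
    by rewrite 2!mxE LB' // (inj_eq enum_val_inj) mxE.
  by case: k / e X Y => X Y /mulmx1C.
- have -> : fro2 L' = \sum_(a <- s) fro2 (row a L).
    rewrite fro2_rows [RHS]big_uniq //= (bigID (mem s)) /= addrC big1 ?add0r => [|a sa].
      by apply: eq_bigr => a sa; rewrite rowL' inE sa.
    by rewrite rowL' inE (negPf sa) fro20.
  by move: fL; rewrite size_tuple; lra.
Qed.

End Selection.

(** * Two bounds for the selected set of columns *)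

Section Interpolation.
Variables (R : realType) (k n : nat) (B : 'M[R]_(k, n)) (C : {set 'I_n}).
Variables (L : 'M[R]_(n, k)) (g : R).
Hypotheses (BB : B *m B^T = 1%:M) (BL : B *m L = 1%:M).
Hypotheses (L0 : forall a, a \notin C -> row a L = 0).
Hypotheses (LB : {in C &, forall a b, (L *m B) a b = (a == b)%:R}).
Hypotheses (fL : fro2 L <= #|C|%:R + g).

(* [W0] and [W1] are the parts of [W = L B] in the columns outside [C] and in
   [C]; the squared norm of [W0] is at most [g]. *)
Let W0 : 'M[R]_n := \matrix_(a, b) (if b \in C then 0 else (L *m B) a b).
Let W1 : 'M[R]_n := \matrix_(a, b) ((a == b) && (b \in C))%:R.

Let LB0 a b : a \notin C -> (L *m B) a b = 0.
Proof.
move=> aC; have : row a (L *m B) = 0 by rewrite row_mul L0 ?mul0mx.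
by move/rowP/(_ b); rewrite !mxE.
Qed.

Let WE a b : (L *m B) a b = W0 a b + W1 a b.
Proof.
rewrite [W0 a b]mxE [W1 a b]mxE; case: ifPn => bC; last by rewrite andbF addr0.
rewrite andbT add0r; have [aC|aC] := boolP (a \in C); first by rewrite LB.
by rewrite LB0 //; case: eqP aC => // ->; rewrite bC.
Qed.

Let fW0 : fro2 W0 <= g.
Proof.
have fLB : fro2 (L *m B) = fro2 L.
  by rewrite -fro2_tr trmx_mul fro2_isometry ?fro2_tr // trmxK.
have fW1 : fro2 W1 = #|C|%:R.
  rewrite -fro2_tr fro2E -sum1_card natr_sum [RHS]big_mkcond /=; apply: eq_bigr => b _.
  rewrite (bigD1 b) //= !mxE eqxx big1 ?addr0 => [|a ab].
    by case: ifP; rewrite ?expr1n ?expr0n.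
  by rewrite !mxE (negPf ab) expr0n.
suff : fro2 (L *m B) = fro2 W0 + fro2 W1 by move: fL; rewrite fLB fW1; lra.
rewrite !fro2E -big_split /=; apply: eq_bigr => a _.
rewrite -big_split /=; apply: eq_bigr => b _; rewrite WE.
by rewrite [W0 a b]mxE [W1 a b]mxE; case: ifP => _; rewrite ?andbF ?expr0n /= ?addr0 ?add0r.
Qed.

(** Every vector agrees, up to a vector supported on [C], with one in the kernel
    of [B] of controlled norm.  Once [x] is made to vanish on [C], as [x'], the
    vectors [x'] and [W x'] have disjoint supports, and [z = x' - W x']. *)
Lemma kernel_representative (x : 'cV[R]_n) :
  exists z y : 'cV[R]_n, [/\ x = z + y, forall a, a \notin C -> y a 0 = 0,
    B *m z = 0 & fro2 z <= (1 + g) * fro2 x].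
Proof.
pose x' : 'cV[R]_n := \col_a (if a \in C then 0 else x a 0).
have LBx' : L *m B *m x' = W0 *m x'.
  apply/matrixP => a b; rewrite !mxE; apply: eq_bigr => c _; rewrite WE.
  by rewrite [W1 a c]mxE [x' c b]mxE; case: ifP; rewrite ?mulr0 // andbF addr0.
have LBx'0 a : a \notin C -> (L *m B *m x') a 0 = 0.
  move=> aC; rewrite -mulmxA mxE big1 // => l _.
  by have /rowP/(_ l) := L0 aC; rewrite !mxE => ->; rewrite mul0r.
have fx' : fro2 x' <= fro2 x.
  rewrite !fro2_cV; apply: ler_sum => a _; rewrite mxE; case: ifP => // _.
  by rewrite expr0n sqr_ge0.
exists (x' - L *m B *m x'), (x - x' + L *m B *m x'); split.
- by rewrite addrACA addNr addr0 addrC subrK.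
- by move=> a aC; rewrite mxE LBx'0 // !mxE (negPf aC) subrr addr0.
- by rewrite mulmxBr !mulmxA BL mul1mx subrr.
rewrite fro2_orth.
  rewrite fro2N LBx'; apply: le_trans (lerD fx' (fro2_mulmx_cV W0 x')) _.
  have := fro2_ge0 W0; have := fro2_ge0 x'; move: fx' fW0.
  by move: (fro2 x') (fro2 W0) (fro2 x) => u v w; nra.
rewrite mulmxN raddfN /= trace_mx11 mxE big1 ?oppr0 // => a _; rewrite 2!mxE.
by case: ifPn => [_|/LBx'0->]; rewrite ?mul0r ?mulr0.
Qed.

(** A lower bound for [B] on vectors supported on [C].  As [w = L (B w)],
    Cauchy-Schwarz gives [|w|^4 <= |L^T w|^2 |B w|^2], and
    [|L^T w|^2 = |W^T w|^2 <= (1 + g) |w|^2]. *)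
Lemma fro2_le_mul_selected (w : 'cV[R]_n) :
  (forall a, a \notin C -> w a 0 = 0) -> fro2 w <= (1 + g) * fro2 (B *m w).
Proof.
move=> w0.
have WD : L *m B = W0 + W1 by apply/matrixP => a b; rewrite WE [RHS]mxE.
have W0w : W0 *m w = 0.
  apply/matrixP => a b; rewrite ord1 !mxE big1 // => c _.
  by rewrite mxE; case: ifPn => [|/w0->]; rewrite ?mul0r ?mulr0.
have W1w : W1 *m w = w.
  apply/matrixP => a b; rewrite ord1 mxE (bigD1 a) //= !mxE eqxx big1 => [|c ca].
    by have [|/w0->] := boolP (a \in C); rewrite addr0 ?mulr0 // mul1r.
  by rewrite mxE eq_sym (negPf ca) mul0r.
have W1tw : W1^T *m w = w.
  rewrite -[RHS]W1w; congr (_ *m _); apply/matrixP => a b; rewrite !mxE eq_sym.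
  by case: eqP => // ->.
have LBw : L *m (B *m w) = w by rewrite mulmxA WD mulmxDl W0w W1w add0r.
have CS : fro2 w ^+ 2 <= fro2 (L^T *m w) * fro2 (B *m w).
  have := Cauchy_Schwarz_fro2 (L^T *m w) (B *m w).
  by rewrite trmx_mul trmxK -mulmxA LBw.
have fLw : fro2 (L^T *m w) = fro2 (W0^T *m w) + fro2 w.
  rewrite -(@fro2_isometry _ _ _ _ B^T) ?trmxK // mulmxA -trmx_mul WD.
  rewrite linearD /= mulmxDl W1tw fro2_orth // trmx_mul trmxK -mulmxA W0w mulmx0.
  exact: mxtrace0.
have := fro2_mulmx_cV W0^T w; rewrite fro2_tr => W0tw.
have [w_eq0|w_neq0] := eqVneq (fro2 w) 0.
  by rewrite w_eq0; rewrite (fro2_eq0 w_eq0) mulmx0 fro20 mulr0.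
have w_gt0 : 0 < fro2 w by rewrite lt_def w_neq0 fro2_ge0.
rewrite -(ler_pM2l w_gt0) -expr2; apply: le_trans CS _; rewrite fLw mulrA.
apply: ler_wpM2r; first exact: fro2_ge0.
by move: W0tw fW0 w_gt0; move: (fro2 w) (fro2 W0) (fro2 _) => u v t; nra.
Qed.

End Interpolation.

(** * Singular values *)

(** The characteristic polynomial of a real symmetric matrix splits: by the
    spectral theorem over [R[i]], its complex roots are real. *)
Lemma char_poly_symmetric_split (R : rcfType) n (S : 'M[R]_n) : S^T = S ->
  exists rs : n.-tuple R, char_poly S = \prod_(r <- rs) ('X - r%:P).
Proof.
move=> St; pose SC := map_mx (real_complex R) S.
have hermS : SC \is hermsymmx.
  apply: realsym_hermsym.
    apply/is_hermitianmxP; rewrite expr0 scale1r map_mx_id //.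
    by apply/matrixP => a b; rewrite !mxE -{1}St mxE.
  by apply/mxOverP => a b; rewrite mxE complex_real.
have /mxOverP dR := hermitian_spectral_diag_real hermS.
have := hermitian_normalmx hermS => /orthomx_spectralP.
move: (spectral_unit SC); move: (spectralmx SC) (spectral_diag SC) dR => P d dR Pu SCE.
(* The matrix is similar to the diagonal matrix of its spectrum. *)
have charS : char_poly SC = \prod_i ('X - (d 0 i)%:P).
  have -> : char_poly SC = char_poly (diag_mx d).
    rewrite SCE /char_poly /char_poly_mx.
    have PP : map_mx polyC (invmx P) *m map_mx polyC P = 1%:M.
      by rewrite -map_mxM mulVmx // map_mx1.
    have -> : 'X%:M - map_mx polyC (invmx P *m diag_mx d *m P) =
       map_mx polyC (invmx P) *m ('X%:M - map_mx polyC (diag_mx d)) *m map_mx polyC P.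
      rewrite !map_mxM mulmxBr mulmxBl; congr (_ - _).
      by rewrite scalar_mxC -mulmxA PP mulmx1.
    by rewrite !det_mulmx mulrAC -det_mulmx PP det1 mul1r.
  rewrite char_poly_trig ?diag_mx_is_trig //.
  by apply: eq_bigr => i _; rewrite mxE eqxx mulr1n.
exists [tuple complex.Re (d 0 i) | i < n].
apply: (@map_poly_inj _ _ (real_complex R)).
rewrite map_char_poly [LHS]charS rmorph_prod /= big_map big_enum /=.
apply: eq_bigr => i _; rewrite rmorphB /= map_polyX map_polyC /=.
by have /complex_realP [r ->] := dR 0 i.
Qed.

Lemma mup_prod_XsubC (F : fieldType) (rs : seq F) x :
  mup x (\prod_(r <- rs) ('X - r%:P)) = count_mem x rs.
Proof.
elim: rs => [|r rs IHrs]; first by rewrite big_nil mupNroot // root1.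
rewrite big_cons mupM ?polyXsubC_eq0 ?monic_neq0 ?monic_prod_XsubC //= IHrs.
by congr (_ + _)%N; have := mup_XsubCX 1 x r; rewrite expr1 => ->; case: eqP.
Qed.

Lemma size_real_roots_mult (R : realType) (rs : seq R) :
  size (real_roots_mult (\prod_(r <- rs) ('X - r%:P))) = size rs.
Proof.
rewrite /real_roots_mult; set p := \prod_(_ <- _) _.
have p0 : p != 0 by rewrite monic_neq0 ?monic_prod_XsubC.
rewrite size_flatten /shape -map_comp sumnE big_map.
have perm_rs : perm_eq (rootsR p) (undup rs).
  apply: uniq_perm; rewrite ?undup_uniq ?uniq_roots // => x.
  have := roots_on_rootsR p0; move=> /(_ x); rewrite in_itv /= => <-.
  by rewrite root_prod_XsubC mem_undup.
rewrite (perm_big _ perm_rs) /= -(perm_size (perm_count_undup rs)).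
rewrite size_flatten /shape -map_comp sumnE big_map.
by apply: eq_bigr => x _; rewrite /= !size_nseq mup_prod_XsubC.
Qed.

Section Singval.
Variables (R : realType) (m n : nat) (A : 'M[R]_(m, n)).

Lemma size_singular_values : size (singular_values A) = n.
Proof.
rewrite /singular_values size_sort size_map.
have [|rs ->] := @char_poly_symmetric_split R n (A^T *m A).
  by rewrite trmx_mul trmxK.
by rewrite size_real_roots_mult size_tuple.
Qed.

Lemma singval_ge0 i : 0 <= singval A i.
Proof.
rewrite /singval; have [lt_i|le_i] := ltnP i.-1 (size (singular_values A)); last first.
  by rewrite nth_default.
have := mem_nth 0 lt_i; rewrite /singular_values mem_sort => /mapP [x _ ->].
exact: sqrtr_ge0.
Qed.

Lemma singval_le i j : (i <= j)%N -> singval A j <= singval A i.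
Proof.
move=> le_ij; rewrite {1}/singval.
have [lt_j|le_j] := ltnP j.-1 (size (singular_values A)); last first.
  by rewrite nth_default // singval_ge0.
apply: (sorted_leq_nth (fun _ _ _ h => ge_trans h) (@lexx _ _)); rewrite ?inE //;
  last 1 first.
- lia.
- by apply: sort_sorted => x y; apply: le_total.
by apply: leq_ltn_trans lt_j; lia.
Qed.

Lemma sigma_min_ge t : (0 < n)%N -> 0 <= t ->
  (forall x : 'cV_n, t ^+ 2 * fro2 x <= fro2 (A *m x)) -> t <= sigma_min A.
Proof.
move=> n_gt0 t0 At; rewrite /sigma_min /singval.
have : (singular_values A)`_n.-1 \in singular_values A.
  by apply: mem_nth; rewrite size_singular_values prednK.
rewrite mem_sort => /mapP [x + ->].
case/flattenP=> _ /mapP [y yP ->] /nseqP [-> _] {x}.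
(* [y] is an eigenvalue; an eigenvector [v^T] is plugged into the hypothesis. *)
have p0 : char_poly (A^T *m A) != 0 by rewrite monic_neq0 ?char_poly_monic.
have : root (char_poly (A^T *m A)) y.
  by move: yP; rewrite -(roots_on_rootsR p0) => /andP [].
rewrite -eigenvalue_root_char => /eigenvalueP [v vA v0].
have fv : 0 < fro2 v^T.
  rewrite lt_def fro2_ge0 andbT; apply: contra v0 => /eqP/fro2_eq0 e.
  by rewrite -[v]trmxK e trmx0.
have := At v^T; rewrite [X in _ <= X](_ : _ = y * fro2 v^T); last first.
  rewrite /fro2 trmx_mul trmxK mulmxA -(mulmxA v) vA -scalemxAl mxtraceZ.
  by [].
rewrite ler_pM2r // => le_ty.
by rewrite -(ger0_norm t0) -sqrtr_sqr ler_wsqrtr.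
Qed.

End Singval.

(** * Consequences of the singular value decomposition *)

Lemma fro2_rect_diag (R : realFieldType) m n (d : nat -> R) (w : 'cV[R]_n) :
  fro2 ((\matrix_(i < m, j < n) if i == j :> nat then d i else 0) *m w) =
  \sum_(j < n | (j < m)%N) d j ^+ 2 * w j 0 ^+ 2.
Proof.
set S := \matrix_(i, j) _.
have SS : S^T *m S = diag_mx (\row_(j < n) (if (j < m)%N then d j ^+ 2 else 0)).
  apply/matrixP => a b; rewrite !mxE; have [am|ma] := ltnP a m.
    rewrite (bigD1 (Ordinal am)) //= !mxE /= eqxx big1 ?addr0 => [|i].
      by rewrite -val_eqE /=; case: eqP => _; rewrite ?mulr0 ?mulr0n // mulr1n expr2.
    by rewrite -val_eqE /= => /negPf ia; rewrite !mxE ia mul0r.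
  rewrite mul0rn big1 // => i _; rewrite !mxE; case: eqP => [ia|]; last by rewrite mul0r.
  by have := ltn_ord i; rewrite ia ltnNge ma.
rewrite /fro2 trmx_mul mulmxA -(mulmxA _ S^T) SS trace_mx11 -mulmxA mul_diag_mx mxE.
rewrite [RHS]big_mkcond; apply: eq_bigr => j _; rewrite !mxE.
by case: ifP => _; rewrite ?mul0r ?mulr0 //; ring.
Qed.

Section SVD.
Variables (R : realType) (m n k : nat) (A : 'M[R]_(m, n)) (Vk : 'M[R]_(n, k)).
Hypothesis AVk : leading_right_singular_vectors A Vk.

Lemma leading_right_singular_vectors_le : (k <= n)%N.
Proof. by case: AVk. Qed.

Lemma leading_right_singular_vectors_orthonormal : Vk^T *m Vk = 1%:M.
Proof.
have [le_kn [U [V [[_ V1 _] ->]]]] := AVk.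
apply/matrixP => a b; have /matrixP/(_ (widen_ord le_kn a) (widen_ord le_kn b)) := V1.
rewrite !mxE -val_eqE /= => <-.
by apply: eq_bigr => c _; rewrite !mxE.
Qed.

(** The singular value decomposition in the coordinates [w] of [x] along the
    right singular vectors, of which the first [k] are [Vk^T x]. *)
Lemma fro2_svd (x : 'cV[R]_n) : exists w : 'cV[R]_n,
  [/\ fro2 x = fro2 w,
      fro2 (A *m x) = \sum_(j < n | (j < m)%N) singval A j.+1 ^+ 2 * w j 0 ^+ 2,
      forall (j : 'I_n) (jk : (j < k)%N), w j 0 = (Vk^T *m x) (Ordinal jk) 0 &
      fro2 (Vk^T *m x) = \sum_(j < n | (j < k)%N) w j 0 ^+ 2].
Proof.
have [le_kn [U [V [[U1 V1 defA] defVk]]]] := AVk.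
have coord (l : 'I_k) : (V^T *m x) (widen_ord le_kn l) 0 = (Vk^T *m x) l 0.
  by rewrite defVk !mxE; apply: eq_bigr => a _; rewrite !mxE.
exists (V^T *m x); split.
- by rewrite fro2_isometry // trmxK; apply: mulmx1C.
- rewrite {1}defA -!mulmxA fro2_isometry //.
  exact: (fro2_rect_diag _ (fun i => singval A i.+1)).
- by move=> j jk; rewrite -coord; congr (_ _ 0); apply: val_inj.
rewrite fro2_cV [RHS](big_ord_narrow le_kn).
by apply: eq_bigr => l _; rewrite coord.
Qed.

Lemma fro2_mul_orth_leading (z : 'cV[R]_n) :
  Vk^T *m z = 0 -> fro2 (A *m z) <= singval A k.+1 ^+ 2 * fro2 z.
Proof.
move=> z0; have [w [-> -> wE _]] := fro2_svd z.
rewrite fro2_cV mulr_sumr big_mkcond; apply: ler_sum => j _.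
case: ifP => _; last by rewrite mulr_ge0 ?sqr_ge0.
have [jk|kj] := ltnP j k.
  by rewrite (wE _ jk) z0 mxE expr0n !mulr0.
by rewrite ler_wpM2r ?sqr_ge0 // ler_sqr ?nnegrE ?singval_ge0 // singval_le.
Qed.

Lemma fro2_mul_ge_leading (x : 'cV[R]_n) : (k <= m)%N ->
  singval A k ^+ 2 * fro2 (Vk^T *m x) <= fro2 (A *m x).
Proof.
move=> le_km; have [w [_ -> _ ->]] := fro2_svd x.
rewrite mulr_sumr [X in X <= _]big_mkcond [X in _ <= X]big_mkcond.
apply: ler_sum => j _; case: ifP => jk; last first.
  by case: ifP => _; rewrite ?lexx // mulr_ge0 ?sqr_ge0.
rewrite (leq_trans jk le_km) ler_wpM2r ?sqr_ge0 //.
by rewrite ler_sqr ?nnegrE ?singval_ge0 // singval_le.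
Qed.

End SVD.

(** * Projection onto the column space *)

Section Orthoproj.
Variables (R : realType) (m p : nat) (X : 'M[R]_(m, p)).

Let cap0 : (<<X^T>> :&: kermx X)%MS = 0.
Proof.
apply/eqP; rewrite -submx0; apply/rV_subP => v; rewrite sub_capmx genmxE.
case/andP=> /submxP [w vw] /sub_kermxP vX; rewrite submx0; apply/eqP.
by apply: fro2_eq0; rewrite -fro2_tr /fro2 trmxK {2}vw trmx_mul trmxK mulmxA vX mul0mx mxtrace0.
Qed.

Lemma orthoproj_mulmx : orthoproj X *m X = X.
Proof. by apply: trmx_inj; rewrite trmx_mul /orthoproj trmxK proj_mx_id ?genmxE. Qed.

Lemma fro2_orthoproj_compl (y : 'cV[R]_m) : fro2 (y - orthoproj X *m y) <= fro2 y.
Proof.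
set P := proj_mx <<X^T>>%MS (kermx X).
(* The row space of [X^T] and the kernel of [X] are complementary, by rank. *)
have full : (y^T <= <<X^T>>%MS + kermx X)%MS.
  apply: submx_full; rewrite /row_full.
  have := mxrank_sum_cap <<X^T>>%MS (kermx X).
  rewrite cap0 mxrank0 addn0 => ->.
  by rewrite genmxE mxrank_tr mxrank_ker subnKC ?rank_leq_row.
have /submxP [w Py] : (y^T *m P <= X^T)%MS.
  by have := proj_mx_sub <<X^T>>%MS (kermx X) y^T; rewrite genmxE.
have /sub_kermxP yP := proj_mx_compl_sub full.
have yPt : (y - orthoproj X *m y)^T = y^T - y^T *m P by rewrite linearB /= trmx_mul trmxK.
rewrite -fro2_tr yPt -[X in _ <= X]fro2_tr -{3}(subrK (y^T *m P) y^T) [X in _ <= X]fro2_orth.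
  by rewrite lerDl fro2_ge0.
rewrite -/P Py in yP.
by rewrite mxtrace_mulC -mxtrace_tr trmx_mul trmxK Py trmx_mul trmxK mulmxA yP mul0mx mxtrace0.
Qed.

End Orthoproj.

(** * Column subset selection *)

Theorem mainTheorem4 (R : realType) (m n k : nat) (A : 'M[R]_(m, n))
    (Vk : 'M[R]_(n, k)) (C : {set 'I_n}) :
  (1 <= k <= \rank A)%N ->
  leading_right_singular_vectors A Vk ->
  mGKS_selects Vk C ->
  specnorm (A - orthoproj (cols A C) *m A)
    <= Num.sqrt (1 + k * (n - k))%N%:R * singval A k.+1
  /\ sigma_min (cols A C) >= singval A k / Num.sqrt (1 + k * (n - k))%N%:R.
Proof.
case/andP=> k_gt0 le_kA AVk [s [BSs defC]].
have le_km : (k <= m)%N := leq_trans le_kA (rank_leq_row A).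
have le_kn := leading_right_singular_vectors_le AVk.
have BB : Vk^T *m Vk^T^T = 1%:M.
  by rewrite trmxK (leading_right_singular_vectors_orthonormal AVk).
have [] := bischof_stewart_inverse le_kn BB BSs; rewrite -defC => cardC.
case=> L [L0 LB BL fL].
have {}LB : {in C &, forall a b, (L *m Vk^T) a b = (a == b)%:R}.
  by move=> a b; rewrite defC !inE; apply: LB.
set g := (k%:R * _) in fL.
have {}fL : fro2 L <= #|C|%:R + g by rewrite cardC.
have defg : (1 + k * (n - k))%N%:R = 1 + g by rewrite natrD natrM natrB.
have g_ge0 : 0 <= g by rewrite mulr_ge0 ?ler0n // subr_ge0 ler_nat.
rewrite defg; set c := Num.sqrt (1 + g).
have c_gt0 : 0 < c by rewrite sqrtr_gt0; lra.
have c_sqr : c ^+ 2 = 1 + g by rewrite sqr_sqrtr //; lra.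
have colsE p (x : 'M_(_, p)) : cols A C *m x = A *m (colsub (@enum_val _ (mem C)) 1%:M *m x).
  by rewrite mulmxA mulmx_colsub mulmx1.
have colsS (y : 'cV[R]_n) : (forall a, a \notin C -> y a 0 = 0) ->
    y = colsub (@enum_val _ (mem C)) 1%:M *m rowsub (@enum_val _ (mem C)) y.
  move=> yC; rewrite -mulmx_supported ?mul1mx // => a /yC ya.
  by apply/matrixP => i j; rewrite !ord1 !mxE.
split.
  apply: ge_sup.
    exists (enorm ((A - orthoproj (cols A C) *m A) *m 0)), 0 => //=.
    by rewrite enormE fro20 sqrtr0.
  move=> _ [x /= x1 <-].
  (* The residual of [A x] is that of [A z], since [A y] is in the range of the
     projection. *)
  have [z [y [xE yC Bz fz]]] := kernel_representative BB BL L0 LB fL x.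
  have Py : (A - orthoproj (cols A C) *m A) *m y = 0.
    by rewrite (colsS y yC) mulmxBl -mulmxA -colsE mulmxA orthoproj_mulmx subrr.
  rewrite xE mulmxDr Py addr0 mulmxBl -mulmxA enormE.
  rewrite -(ger0_norm (mulr_ge0 (ltW c_gt0) (singval_ge0 A k.+1))) -sqrtr_sqr ler_wsqrtr //.
  apply: le_trans (fro2_orthoproj_compl _ _) _.
  apply: le_trans (fro2_mul_orth_leading AVk Bz) _.
  rewrite exprMn mulrC ler_wpM2r ?sqr_ge0 // c_sqr.
  have fx : fro2 x <= 1 by rewrite -enorm_sqr expr_le1 // enormE sqrtr_ge0.
  by apply: le_trans fz _; rewrite -[X in _ <= X]mulr1 ler_wpM2l // addr_ge0.
apply: sigma_min_ge; first by rewrite cardC.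
  by rewrite divr_ge0 ?singval_ge0 ?ltW.
move=> x; rewrite colsE; set w := colsub _ _ *m x.
have wC a : a \notin C -> w a 0 = 0.
  move=> aC; rewrite mxE big1 // => l _; rewrite !mxE; case: eqP => [al|]; last by rewrite mul0r.
  by rewrite al enum_valP in aC.
have fwx : fro2 w = fro2 x.
  apply: fro2_isometry; rewrite trmx_mxsub trmx1 -mxsub_mul mul1mx.
  by apply/matrixP => i j; rewrite !mxE (inj_eq enum_val_inj).
apply: le_trans (fro2_mul_ge_leading AVk w le_km).
rewrite expr_div_n c_sqr -fwx -mulrA ler_wpM2l ?sqr_ge0 //.
have g1_gt0 : 0 < 1 + g by rewrite ltr_pwDl.
rewrite ler_pdivrMl //; exact: (fro2_le_mul_selected BB L0 LB fL wC).
Qed.
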